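(* Let $(X,\mathcal{B})$ be a premeasurable space, let $\sigma(\mathcal{B})$ be the $\sigma$-algebra generated by $\mathcal{B}$, let $F_{\mathcal{B}},F_{\sigma(\mathcal{B})},G:\mathbf{Part}_c^f\to\mathbf{Pos}$ be the enriched functors described in the context and let $\iota:F_{\mathcal{B}}\to F_{\sigma(\mathcal{B})}$ be the strict transformation whose components $\iota_A:F_{\mathcal{B}}A\to F_{\sigma(\mathcal{B})}A$ are the inclusions. Then for every strict transformation $\tau:F_{\mathcal{B}}\to G$ the right extension of $\tau$ along $\iota$ (among strict transformations) exists and is proper.
   Context: A premeasurable space is a set $X$ with an algebra $\mathcal{B}$ of subsets (closed under finite unions and complements). $\mathbf{Pos}$ is the category of posets and order-preserving maps, enriched over itself by the pointwise order. For a countable (possibly finite) set $A$, $\mathcal{P}_f(A)$ is the algebra of finite and cofinite subsets of $A$. A partial map $f:A\to B$ of countable sets is finite if $f^{-1}(B')\in\mathcal{P}_f(A)$ for all $B'\in\mathcal{P}_f(B)$, where $f^{-1}(B')=\{a\in\mathrm{dom} f: f(a)\in B'\}$. $\mathbf{Part}_c^f$ is the poset-enriched category of countable sets and finite partial maps, where $f_1\le f_2$ iff $\mathrm{dom} f_1\subseteq\mathrm{dom} f_2$ and $f_1=f_2$ on $\mathrm{dom} f_1$. For an algebra $\mathcal{B}$ on $X$, $F_{\mathcal{B}}A$ is the poset of families $(E_a)_{a\in A}$ of pairwise disjoint elements of $\mathcal{B}$ with $\bigcup_{a\in A}E_a\in\mathcal{B}$, ordered by componentwise inclusion; for a finite partial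 map $f:A\to B$, $F_{\mathcal{B}}f((E_a)_a)=\left(\bigcup_{f(a)=b}E_a\right)_{b\in B}$. (Equivalently, $F_{\mathcal B}A$ is the poset of partial maps $g:X\to A$ with $g^{-1}(A')\in\mathcal{B}$ for all $A'\in\mathcal{P}_f(A)$.) $F_{\sigma(\mathcal{B})}$ is the same construction applied to the algebra $\sigma(\mathcal{B})$. $GA=[0,\infty]^A$ with the pointwise order and $Gf((p_a)_a)=\left(\sum_{f(a)=b}p_a\right)_{b\in B}$. For enriched functors $F,G:\mathcal{C}\to\mathbf{Pos}$, a strict transformation $\tau:F\to G$ is a family of order-preserving maps $(\tau_A:FA\to GA)_A$ with $Gf\circ\tau_A=\tau_B\circ Ff$ for all morphisms $f:A\to B$ of $\mathcal{C}$; strict transformations are ordered pointwise. Given strict transformations $\iota:F\to H$ and $\tau:F\to G$, the right extension of $\tau$ along $\iota$ is a strict transformation $\mathrm{Ran}_\iota\tau:H\to G$ with $\mathrm{Ran}_\iota\tau\circ\iota\le\tau$ and such that every strict $\tau':H\to G$ with $\tau'\circ\iota\le\tau$ satisfies $\tau'\le\mathrm{Ran}_\iota\tau$. It is proper if $\mathrm{Ran}_\iota\tau\circ\iota=\tau$. *)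

(* Defs.v *)
From HB Require Import structures.
From mathcomp Require Import all_boot all_order all_algebra.
From mathcomp Require Import all_classical all_reals all_analysis.

Set Implicit Arguments.
Unset Strict Implicit.
Unset Printing Implicit Defensive.

Import Order.TTheory GRing.Theory Num.Theory.

Local Open Scope ring_scope.
Local Open Scope order_scope.
Local Open Scope classical_set_scope.

Record pos_category (d : Order.disp_t) := PosCategory {
  obj :> Type;
  hom : obj -> obj -> porderType d;
  idm : forall A, hom A A;
  comp : forall A B C, hom B C -> hom A B -> hom A C;
  comp_idl : forall A B (f : hom A B), comp (idm B) f = f;
  comp_idr : forall A B (f : hom A B), comp f (idm A) = f;
  compA : forall A B C D (h : hom C D) (g : hom B C) (f : hom A B),
    comp h (comp g f) = comp (comp h g) f;
  comp_le : forall A B C (g g' : hom B C) (f f' : hom A B),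
    g <= g' -> f <= f' -> comp g f <= comp g' f' }.
Arguments hom {d C} A B : rename.
Arguments idm {d C} A : rename.
Arguments comp {d C A B C0} g f : rename.

(** Enriched functors from [C] to posets and order-preserving maps: the hom-sets
    of the target carry the pointwise order, so preservation of the enrichment
    is [fmap_le]. *)
Record pos_functor (d : Order.disp_t) (C : pos_category d)
    (d' : Order.disp_t) := PosFunctor {
  fobj :> C -> porderType d';
  fmap : forall A B : C, hom A B -> {omorphism fobj A -> fobj B};
  fmap_id : forall A : C, fmap (idm A) =1 id;
  fmap_comp : forall (A B D : C) (g : hom B D) (f : hom A B),
    fmap (comp g f) =1 fmap g \o fmap f;
  fmap_le : forall (A B : C) (f g : hom A B), f <= g ->
    forall x, fmap f x <= fmap g x }.
Arguments fmap {d C d'} F {A B} f : rename.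

Section StrictTransformations.
Context {d : Order.disp_t} {C : pos_category d}.

Record strict_trans {d1 d2 : Order.disp_t}
    (F : pos_functor C d1) (G : pos_functor C d2) := StrictTrans {
  component :> forall A : C, {omorphism F A -> G A};
  naturality : forall (A B : C) (f : hom A B),
    fmap G f \o component A =1 component B \o fmap F f }.

Definition le_strict {d1 d2} {F : pos_functor C d1} {G : pos_functor C d2}
  (s t : strict_trans F G) : Prop := forall (A : C) (x : F A), s A x <= t A x.

Lemma strict_trans_ext {d1 d2} {F : pos_functor C d1} {G : pos_functor C d2}
  (s t : strict_trans F G) : (forall A : C, s A =1 t A) -> s = t.
Proof.
case: s t => [s ns] [t nt] /= st.
have est : s = t.
  apply: functional_extensionality_dep => A.
  case: (s A) (t A) (st A) => [u [[cu]]] [v [[cv]]] /= /funext uv.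
  by move: cu cv; rewrite uv => cu cv; rewrite (Prop_irrelevance cu cv).
by move: ns nt; rewrite est => ns nt; rewrite (Prop_irrelevance ns nt).
Qed.

Section Comp.
Context {d1 d2 d3 : Order.disp_t}.
Context {F : pos_functor C d1} {H : pos_functor C d2} {G : pos_functor C d3}.
Variables (t : strict_trans H G) (s : strict_trans F H).

Lemma comp_strict_naturality (A B : C) (f : hom A B) :
  fmap G f \o (t A \o s A) =1 (t B \o s B) \o fmap F f.
Proof.
move=> x /=; have /= -> := naturality t f (s A x).
by have /= -> := naturality s f x.
Qed.

Definition comp_strict : strict_trans F G :=
  @StrictTrans _ _ F G (fun A : C => t A \o s A : {omorphism F A -> G A})
    comp_strict_naturality.

End Comp.

Section RightExtension.
Context {d1 d2 d3 : Order.disp_t}.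
Context {F : pos_functor C d1} {H : pos_functor C d2} {G : pos_functor C d3}.
Variables (iota : strict_trans F H) (tau : strict_trans F G).

Definition is_right_extension (rho : strict_trans H G) : Prop :=
  le_strict (comp_strict rho iota) tau /\
  forall tau' : strict_trans H G,
    le_strict (comp_strict tau' iota) tau -> le_strict tau' rho.

Definition is_proper_extension (rho : strict_trans H G) : Prop :=
  comp_strict rho iota = tau.

End RightExtension.
End StrictTransformations.

Definition fin_cofin {A : Type} : set (set A) :=
  [set A' | finite_set A' \/ finite_set (~` A')].

(** A partial map is encoded by [option]: [f a = None] outside its domain. *)
Section PartialMaps.
Context {A B : Type}.
Implicit Types f g : A -> option B.

Definition pdom f : set A := [set a | exists b, f a = Some b].

Definition ppreimage f (B' : set B) : set A :=
  [set a | exists2 b, f a = Some b & B' b].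

Definition finite_pmap f : Prop :=
  forall B' : set B, fin_cofin B' -> fin_cofin (ppreimage f B').

End PartialMaps.

Record finpmap (A B : Type) := FinPMap {
  pmap_fun :> A -> option B;
  pmap_finite : `[< finite_pmap pmap_fun >] }.

HB.instance Definition _ (A B : Type) := [isSub for @pmap_fun A B].
HB.instance Definition _ (A B : Type) := gen_eqMixin (finpmap A B).
HB.instance Definition _ (A B : Type) := gen_choiceMixin (finpmap A B).

Section FinPMapOrder.
Context {A B : Type}.
Implicit Types f g h : finpmap A B.

Lemma finpmapP f : finite_pmap f. Proof. exact/asboolP/pmap_finite. Qed.

Lemma finpmap_ext f g : f =1 g -> f = g.
Proof. by move=> fg; apply/val_inj/funext. Qed.

Definition le_finpmap f g : bool :=
  `[< pdom f `<=` pdom g /\ forall a, pdom f a -> f a = g a >].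

Lemma le_finpmap_refl : reflexive le_finpmap.
Proof. by move=> f; apply/asboolP; split. Qed.

Lemma le_finpmap_anti : antisymmetric le_finpmap.
Proof.
move=> f g /andP[/asboolP[fg efg] /asboolP[gf _]]; apply/finpmap_ext => a.
have [/efg//|nfa] := pselect (pdom f a).
have nga : ~ pdom g a by move=> /gf.
case efa: (f a) => [b|]; first by case: nfa; exists b.
by case ega: (g a) => [c|]; first by case: nga; exists c.
Qed.

Lemma le_finpmap_trans : transitive le_finpmap.
Proof.
move=> g f h /asboolP[fg efg] /asboolP[gh egh]; apply/asboolP; split.
  exact: subset_trans gh.
by move=> a fa; rewrite efg//; apply/egh/fg.
Qed.

Lemma finpmap_display : Order.disp_t. Proof. exact: Order.default_display. Qed.

HB.instance Definition _ := Order.Le_isPOrder.Build finpmap_display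
  (finpmap A B) le_finpmap_refl le_finpmap_anti le_finpmap_trans.

Lemma finpmap_le_Some f g a b : f <= g -> f a = Some b -> g a = Some b.
Proof. by move=> /asboolP[_ fg] fa; rewrite -fg//; exists b. Qed.

Lemma finpmap_leP f g :
  (forall a b, f a = Some b -> g a = Some b) -> f <= g.
Proof.
move=> fg; apply/asboolP; split=> [a [b /fg]|a [b fa]]; first by exists b.
by rewrite fa (fg _ _ fa).
Qed.

End FinPMapOrder.

Section PartialMapComposition.

Lemma finite_pmap_id (A : Type) : finite_pmap (@Some A).
Proof.
move=> A' fA'; suff -> : ppreimage (@Some A) A' = A' by [].
by apply/seteqP; split=> a /=; [case=> b [->]|exists a].
Qed.

Definition finpmap_id (A : Type) : finpmap A A :=
  FinPMap (asboolT (@finite_pmap_id A)).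

Lemma finite_pmap_comp (A B C : Type) (g : finpmap B C) (f : finpmap A B) :
  finite_pmap (obind g \o f).
Proof.
move=> C' fC'; have := finpmapP f (finpmapP g fC').
suff -> : ppreimage f (ppreimage g C') = ppreimage (obind g \o f) C' by [].
apply/seteqP; split=> a /= [].
  by move=> b /= fa [c gb Cc]; exists c => //=; rewrite fa.
move=> c /=; case fa: (f a) => [b|//] /= gb Cc.
by exists b => //; exists c.
Qed.

Definition finpmap_comp (A B C : Type) (g : finpmap B C) (f : finpmap A B) :
  finpmap A C := FinPMap (asboolT (finite_pmap_comp g f)).

End PartialMapComposition.

(** The category of countable sets and finite partial maps.  An object is a
    type together with an injection into [nat]; this injection plays no role in
    the morphisms. *)
Program Definition part_cf : pos_category finpmap_display :=
  @PosCategory _ countType (fun A B => finpmap A B) finpmap_id finpmap_comp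
    _ _ _ _.
Next Obligation. by move=> A B f; apply/finpmap_ext => a /=; case: (f a). Qed.
Next Obligation. by move=> A B f; apply/finpmap_ext. Qed.
Next Obligation.
by move=> A B C D h g f; apply/finpmap_ext => a /=; case: (f a).
Qed.
Next Obligation.
move=> A B C g g' f f' gg' ff'; apply: finpmap_leP => a c /=.
case fa: (f a) => [b|//] /= gb; rewrite (finpmap_le_Some ff' fa) /=.
exact: finpmap_le_Some gb.
Qed.

Definition fiber (A B : Type) (f : A -> option B) (b : B) : set A :=
  [set a | f a = Some b].

(** Explicit, rather than through [algebraOfSetsType], whose carriers are pointed
    and hence nonempty; the same definitions then apply to [B] and [<<s B >>]. *)
Definition set_algebra (X : Type) (B : set (set X)) : Prop :=
  [/\ B set0, setU_closed B & setC_closed B].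

Lemma sigma_set_algebra (X : Type) (B : set (set X)) : set_algebra <<s B >>.
Proof.
have [s0 sC sU] := smallest_sigma_algebra [set: X] B.
split=> [//|P Q BP BQ|P BP]; last by rewrite -setTD; exact: sC.
by rewrite -bigcup2E; apply: sU => -[|[|n]] //=.
Qed.

Definition set_family (X : Type) (B : set (set X)) (A : Type) (E : A -> set X) :
    Prop :=
  [/\ trivIset setT E, forall a, B (E a) & B (\bigcup_a E a)].

Record sfamily (X : Type) (B : set (set X)) (A : Type) := SFamily {
  sfamily_fun :> A -> set X;
  sfamily_prop : `[< set_family B sfamily_fun >] }.

Lemma sfamily_display : Order.disp_t. Proof. exact: Order.default_display. Qed.

HB.instance Definition _ (X : Type) (B : set (set X)) (A : Type) :=
  [isSub for @sfamily_fun X B A].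
HB.instance Definition _ (X : Type) (B : set (set X)) (A : Type) :=
  [Choice of sfamily B A by <:].
HB.instance Definition _ (X : Type) (B : set (set X)) (A : Type) :=
  [SubChoice_isSubPOrder of sfamily B A by <: with sfamily_display].

Section SetFamilies.
Context {X : Type} {B : set (set X)} (algB : set_algebra B).

Lemma sfamilyP (A : Type) (E : sfamily B A) : set_family B E.
Proof. exact/asboolP/sfamily_prop. Qed.

Lemma sfamily_ext (A : Type) (E E' : sfamily B A) : E =1 E' -> E = E'.
Proof. by move=> EE'; apply/val_inj/funext. Qed.

Lemma sfamily_leP (A : Type) (E E' : sfamily B A) :
  reflect (forall a, E a `<=` E' a) (E <= E').
Proof.
apply: (iffP idP) => [/asboolP EE' a|EE']; first exact/subsetPset/EE'.
by apply/asboolP => a; apply/subsetPset/EE'.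
Qed.

Lemma set_algebraD (P Q : set X) : B P -> B Q -> B (P `\` Q).
Proof.
have [_ BU BC] := algB => BP BQ.
by rewrite setDE -[P]setCK -setCU; apply/BC/BU => //; exact: BC.
Qed.

Lemma bigcup_fin_cofin (A : Type) (E : A -> set X) (A' : set A) :
  set_family B E -> fin_cofin A' -> B (\bigcup_(a in A') E a).
Proof.
have [B0 BU BC] := algB => -[tE BE BUE].
have BF D : finite_set D -> B (\bigcup_(a in D) E a).
  by move=> fD; have /fin_bigcup_closedP := conj B0 BU; apply.
move=> -[/BF//|/BF BC']; rewrite (_ : \bigcup_(a in A') E a =
  (\bigcup_a E a) `\` (\bigcup_(a in ~` A') E a)); first exact: set_algebraD.
apply/seteqP; split=> [x [a A'a Eax]|x [[a _ Eax] nx]].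
  split; first by exists a.
  move=> [b nb Ebx]; apply: nb; suff -> : b = a by [].
  by apply: tE => //; exists x.
by exists a => //; apply: contrapT => na; apply: nx; exists a.
Qed.

Lemma sfamily_map_subproof (A A' : Type) (f : finpmap A A') (E : sfamily B A) :
  set_family B (fun b => \bigcup_(a in fiber f b) E a).
Proof.
have [tE BE BUE] := sfamilyP E; split.
- move=> b c _ _ [x [[a fa Eax] [a' fa' Ea'x]]].
  have aa' : a = a' by apply: tE => //; exists x.
  by move: fa fa'; rewrite /fiber/= aa' => -> [].
- move=> b; apply: bigcup_fin_cofin; first exact: sfamilyP.
  have : fin_cofin [set b] by left; exact: finite_set1.
  move/(finpmapP f); congr (fin_cofin _); apply/seteqP; split=> a /=.
    by case=> c fa <-.
  by exists b.
- rewrite (_ : \bigcup_b _ = \bigcup_(a in ppreimage f setT) E a).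
    apply: bigcup_fin_cofin; first exact: sfamilyP.
    by apply: finpmapP; right; rewrite setCT; exact: finite_set0.
  apply/seteqP; split=> x.
    by move=> [b _ [a fa Eax]]; exists a => //; exists b.
  by move=> [a [b fa _] Eax]; exists b => //; exists a.
Qed.

Definition sfamily_map (A A' : Type) (f : finpmap A A') (E : sfamily B A) :
  sfamily B A' := SFamily (asboolT (sfamily_map_subproof f E)).

Lemma sfamily_map_le (A A' : Type) (f : finpmap A A') :
  {homo sfamily_map f : E E' / E <= E'}.
Proof.
move=> E E' /sfamily_leP EE'; apply/sfamily_leP => b x [a fa Eax].
by exists a => //; exact: EE'.
Qed.

HB.instance Definition _ (A A' : Type) (f : finpmap A A') :=
  Order.isOrderMorphism.Build _ (sfamily B A) _ (sfamily B A')
    (sfamily_map f) (@sfamily_map_le A A' f).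

Program Definition sfamily_functor : pos_functor part_cf sfamily_display :=
  @PosFunctor _ part_cf _ (fun A : countType => sfamily B A)
    (fun A A' (f : finpmap A A') => sfamily_map f) _ _ _.
Next Obligation.
move=> A E; apply/sfamily_ext => a; apply/seteqP; split=> [x [b [->]]//|x Ex].
by exists a.
Qed.
Next Obligation.
move=> A A' A2 g f E; apply/sfamily_ext => c; apply/seteqP; split=> x /=.
  move=> [a]; rewrite /fiber/=; case fa: (f a) => [b|//] /= gb Ex.
  by exists b => //; exists a.
by move=> [b gb [a fa Ex]]; exists a => //; rewrite /fiber/= fa.
Qed.
Next Obligation.
move=> A A' f g fg E; apply/sfamily_leP => b x [a fa Ex].
by exists a => //; exact: finpmap_le_Some fa.
Qed.

End SetFamilies.

Section Inclusion.
Context {X : Type} {B : set (set X)}.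

Lemma sfamily_incl_subproof (A : Type) (E : sfamily B A) :
  set_family <<s B >> E.
Proof.
have [tE BE BUE] := sfamilyP E.
by split=> // [a|]; exact: sub_gen_smallest.
Qed.

Definition sfamily_incl (A : Type) (E : sfamily B A) : sfamily <<s B >> A :=
  SFamily (asboolT (sfamily_incl_subproof E)).

Lemma sfamily_incl_le (A : Type) :
  {homo @sfamily_incl A : E E' / E <= E'}.
Proof. by []. Qed.

HB.instance Definition _ (A : Type) :=
  Order.isOrderMorphism.Build _ (sfamily B A) _ (sfamily <<s B >> A)
    (@sfamily_incl A) (@sfamily_incl_le A).

Variable algB : set_algebra B.

Lemma sfamily_incl_natural (A A' : countType) (f : finpmap A A') :
  sfamily_map (sigma_set_algebra B) f \o @sfamily_incl A =1
  @sfamily_incl A' \o sfamily_map algB f.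
Proof. by move=> E; exact: sfamily_ext. Qed.

Definition sigma_inclusion : strict_trans (sfamily_functor algB)
    (sfamily_functor (sigma_set_algebra B)) :=
  @StrictTrans _ part_cf _ _ (sfamily_functor algB)
    (sfamily_functor (sigma_set_algebra B))
    (fun A : countType => @sfamily_incl A) sfamily_incl_natural.

End Inclusion.

(** The elements of [0, +oo]^A. *)
Record nneg_fun (R : realType) (A : Type) := NNegFun {
  nneg_fun_val :> A -> \bar R;
  nneg_fun_prop : `[< forall a, (0 <= nneg_fun_val a)%E >] }.

Lemma nneg_fun_display : Order.disp_t. Proof. exact: Order.default_display. Qed.

HB.instance Definition _ R A := [isSub for @nneg_fun_val R A].
HB.instance Definition _ R A := [Choice of nneg_fun R A by <:].
HB.instance Definition _ (R : realType) (A : Type) :=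
  [SubChoice_isSubPOrder of nneg_fun R A by <: with nneg_fun_display].

Section NNegFun.
Context {R : realType}.

Lemma nneg_funP (A : Type) (p : nneg_fun R A) a : (0 <= p a)%E.
Proof. by move: a; exact/asboolP/nneg_fun_prop. Qed.

Lemma nneg_fun_ext (A : Type) (p q : nneg_fun R A) : p =1 q -> p = q.
Proof. by move=> pq; apply/val_inj/funext. Qed.

Lemma nneg_fun_leP (A : Type) (p q : nneg_fun R A) :
  reflect (forall a, (p a <= q a)%E) (p <= q).
Proof. exact: (iffP (asboolP _)). Qed.

Lemma nneg_fun_map_subproof (A : countType) (B : Type) (f : finpmap A B)
    (p : nneg_fun R A) b :
  (0 <= \esum_(a in fiber f b) p a)%E.
Proof. by apply: esum_ge0 => a _; exact: nneg_funP. Qed.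

Definition nneg_fun_map (A : countType) (B : Type) (f : finpmap A B)
    (p : nneg_fun R A) : nneg_fun R B :=
  NNegFun (asboolT (nneg_fun_map_subproof f p)).

Lemma nneg_fun_map_le (A : countType) (B : Type) (f : finpmap A B) :
  {homo nneg_fun_map f : p q / p <= q}.
Proof.
move=> p q /nneg_fun_leP pq; apply/nneg_fun_leP => b /=.
by apply: le_esum => a _; exact: pq.
Qed.

HB.instance Definition _ (A : countType) (B : Type) (f : finpmap A B) :=
  Order.isOrderMorphism.Build _ (nneg_fun R A) _ (nneg_fun R B)
    (nneg_fun_map f) (@nneg_fun_map_le A B f).

End NNegFun.

Program Definition nneg_fun_functor (R : realType) :
    pos_functor part_cf nneg_fun_display :=
  @PosFunctor _ part_cf _ (fun A : countType => nneg_fun R A)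
    (fun (A B : countType) (f : finpmap A B) => nneg_fun_map f) _ _ _.
Next Obligation.
move=> R A p; apply/nneg_fun_ext => a /=.
rewrite -[RHS](@esum_set1 R _ a p) ?nneg_funP//.
by congr esum; apply/seteqP; split=> b /=; [case|move=> ->].
Qed.
Next Obligation.
move=> R A B C g f p; apply/nneg_fun_ext => c /=.
rewrite esum_esum; last by move=> *; exact: nneg_funP.
apply: (@reindex_esum _ _ _ (fiber g c `*`` fiber f) _ snd); split=> /=.
- by move=> [b a] /= [gb fa]; rewrite /fiber/= fa.
- move=> [b a] [b' a'] /set_mem[/= _ fa] /set_mem[/= _ fa'] aa'.
  by move: fa'; rewrite -aa' /fiber/= fa => -[<-].
- move=> a; rewrite /fiber/=; case fa: (f a) => [b|//] /= gb.
  by exists (b, a).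
Qed.
Next Obligation.
move=> R A B f g fg p; apply/nneg_fun_leP => b /=.
rewrite [leRHS](esumID (fiber f b)); last by move=> a _; exact: nneg_funP.
rewrite (_ : fiber g b `&` fiber f b = fiber f b); last first.
  by apply/setIidr => a; exact: finpmap_le_Some.
by apply: leeDl; apply: esum_ge0 => a _; exact: nneg_funP.
Qed.

(* Main.v *)
(** The point maps [A -> 1] show that a strict transformation [tau : F_S -> G] is
    determined by its component at the one-point set, i.e. by the set function
    [mu P = tau_1 P] on [S]; naturality along the total maps [A -> 1] is countable
    additivity of [mu]. Strict transformations [F_S -> G] are thus the same as
    premeasures on [S], compared pointwise. The right extension of [tau] is given
    by the Caratheodory outer measure of [mu]: it is a measure on [<<s B >>]
    extending [mu], and it is the largest measure whose restriction to [B] is below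
    [mu], because for such a [nu] and any cover of [P] by sets [F n] of [B] we have
    [nu P <= \sum_n nu (F n) <= \sum_n mu (F n)]. *)
Require Import Defs.
From HB Require Import structures.
From mathcomp Require Import all_boot all_order all_algebra.
From mathcomp Require Import all_classical all_reals all_analysis.

Set Implicit Arguments.
Unset Strict Implicit.
Unset Printing Implicit Defensive.

Import Order.TTheory GRing.Theory Num.Theory.

Local Open Scope ring_scope.
Local Open Scope classical_set_scope.
Local Open Scope ereal_scope.

(** Nonnegativity is required of all sets: values outside [S] are junk, but the
    library's measures are total nonnegative functions. *)
Definition premeasure (R : realType) (X : Type) (S : set (set X))
    (mu : set X -> \bar R) : Prop :=
  [/\ mu set0 = 0, forall P, 0 <= mu P &
    forall F : (set X)^nat, (forall n, S (F n)) -> trivIset setT F ->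
      S (\bigcup_n F n) -> mu (\bigcup_n F n) = \sum_(n <oo) mu (F n)].

(** An alias of [X] indexed by [algS], so that the structures given by [S] and by [<<s S >>] can
    coexist on the same points. *)
Definition set_algebraType (X : Type) (S : set (set X)) (algS : set_algebra S) :=
  X.

Section SetAlgebraType.
Variables (X : pointedType) (S : set (set X)) (algS : set_algebra S).

Let S0 : S set0. Proof. by case: algS. Qed.
Let SU : setU_closed S. Proof. by case: algS. Qed.
Let SC : setC_closed S. Proof. by case: algS. Qed.

HB.instance Definition _ := Pointed.on (set_algebraType algS).
HB.instance Definition _ := @isAlgebraOfSets.Build default_measure_display
  (set_algebraType algS) S S0 SU SC.

End SetAlgebraType.

Section PremeasureMeasure.
Context {R : realType} {X : pointedType} {S : set (set X)}.
Variables (algS : set_algebra S) (mu : set X -> \bar R).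
Hypothesis pmu : premeasure S mu.

(** The proof of [premeasure S mu] is an argument so that the measure instance
    below can be found by unification. *)
Definition premeasure_fun of premeasure S mu :
  set (set_algebraType algS) -> \bar R := mu.

Local Notation pm := (premeasure_fun pmu).

Let pm0 : pm set0 = 0. Proof. by case: pmu. Qed.
Let pm_ge0 P : 0 <= pm P. Proof. by case: pmu. Qed.
Let pm_semi_sigma_additive : semi_sigma_additive pm.
Proof.
move=> F mF tF mUF; have [_ _ /(_ F mF tF mUF)] := pmu.
rewrite /premeasure_fun => ->.
by apply: is_cvg_nneseries => n _ _; exact: pm_ge0.
Qed.

HB.instance Definition _ := isMeasure.Build _ _ _ pm
  pm0 pm_ge0 pm_semi_sigma_additive.

Definition premeasure_measure :
  {measure set (set_algebraType algS) -> \bar R} := pm.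

End PremeasureMeasure.

(** * Additivity and extension of premeasures *)

Lemma premeasure_le (R : realType) (X : Type) (S : set (set X))
    (mu : set X -> \bar R) P Q :
  set_algebra S -> premeasure S mu -> S P -> S Q -> P `<=` Q -> mu P <= mu Q.
Proof.
elim/Ppointed: X => X in S mu P Q *; first by rewrite !emptyE.
move=> algS pmu SP SQ PQ.
have := le_measure (premeasure_measure algS pmu).
by move=> /(_ P Q); rewrite !inE; apply.
Qed.

Lemma premeasure_bigcup (R : realType) (X : Type) (S : set (set X))
    (mu : set X -> \bar R) (A : countType) (D : set A) (E : A -> set X) :
    set_algebra S -> premeasure S mu ->
    trivIset D E -> (forall a, D a -> S (E a)) -> S (\bigcup_(a in D) E a) ->
  mu (\bigcup_(a in D) E a) = \esum_(a in D) mu (E a).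
Proof.
move=> [S0 _ _] [mu0 mu_ge0 mu_add].
move=> tE SE SUE.
(* Reindexing by codes: [F n] is the member of the family whose index has code [n], and is empty if
   there is none. *)
pose F n := \bigcup_(a in D `&` [set a | pickle a = n]) E a.
have FE a : D a -> F (pickle a) = E a.
  move=> Da; apply/seteqP; split=> [x [b [_ /(pcan_inj pickleK) ->]]//|x Ex].
  by exists a.
have F0 n : ~ (pickle @` D) n -> F n = set0.
  by move=> nD; apply: bigcup0 => a [Da an]; case: nD; exists a.
have UF : \bigcup_n F n = \bigcup_(a in D) E a.
  apply/seteqP; split=> x; first by move=> [n _ [a [Da _] Ex]]; exists a.
  by move=> [a Da Ex]; exists (pickle a) => //; exists a.
rewrite -UF mu_add ?UF //; first last.
- move=> m n _ _ [x [[a [Da <-] Ea] [b [Db <-] Eb]]].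
  by congr pickle; apply: tE => //; exists x.
- move=> n; have [[a Da <-]|/F0 ->//] := pselect ((pickle @` D) n).
  by rewrite FE//; exact: SE.
rewrite nneseries_esumT//; transitivity (\esum_(n in pickle @` D) mu (F n)).
  rewrite [RHS]esum_mkcond; apply: eq_esum => n _.
  by case: ifPn => //; rewrite notin_setE => /F0 ->.
rewrite esum_image; first by apply: eq_esum => a Da; rewrite FE.
by move=> a b _ _; exact: (pcan_inj pickleK).
Qed.

Lemma premeasure_extension (R : realType) (X : Type) (S : set (set X))
    (mu : set X -> \bar R) (algS : set_algebra S) (pmu : premeasure S mu) :
  exists nu, [/\ premeasure <<s S >> nu, forall P, S P -> nu P = mu P &
    forall nu', premeasure <<s S >> nu' ->
      (forall P, S P -> nu' P <= mu P) ->
    forall P, <<s S >> P -> nu' P <= nu P].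
Proof.
have [mu0 mu_ge0 mu_add] := pmu.
elim/Ppointed: X => X in S algS mu pmu mu0 mu_ge0 mu_add *.
  (* On an empty space every set is empty, hence in [S], and [mu] is its own extension. *)
  have SP P : S P by rewrite emptyE; case: algS.
  exists mu; split=> // [|nu' _ nu'mu P _]; last exact: nu'mu.
  by split=> // F _ tF _; exact: mu_add.
pose m := premeasure_measure algS pmu.
exists (m^*)%mu; split.
- split=> [|P|F SF tF SUF].
  + exact: outer_measure0.
  + exact: outer_measure_ge0.
  + exact: (measure_semi_bigcup (measure_extension m)).
- by move=> P SP; exact: (measurable_mu_extE m).
- move=> nu' pnu' nu'mu P SP.
  pose m' := premeasure_measure (sigma_set_algebra S) pnu'.
  apply: le_ereal_inf_tmp => _ [F [SF PF] <-].
  apply: (@le_trans _ _ (\sum_(n <oo) nu' (F n))).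
    apply: (@measure_sigma_subadditive _ _ _ m') => // n.
    by change (<<s S >> (F n)); apply: sub_gen_smallest; exact: SF.
  have [_ nu'0 _] := pnu'.
  by apply: lee_nneseries => n _ //; exact/nu'mu/SF.
Qed.

(** * From premeasures to strict transformations *)

Section TransOfPremeasure.
Context {R : realType} {X : Type} {S : set (set X)}.
Variables (algS : set_algebra S) (mu : set X -> \bar R).
Hypothesis pmu : premeasure S mu.

Lemma premeasure_ge0 P : 0 <= mu P. Proof. by case: pmu. Qed.

(** Monotonicity depends on [algS]; having it as an argument lets unification find the
    order-morphism instance. *)
Definition premeasure_component of set_algebra S :=
  fun (A : Type) (E : sfamily S A) =>
  NNegFun (asboolT (fun a : A => premeasure_ge0 (E a))).

Lemma premeasure_component_le (A : Type) :
  {homo @premeasure_component algS A : E E' / (E <= E')%O}.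
Proof.
move=> E E' /sfamily_leP EE'; apply/nneg_fun_leP => a /=.
have [_ SE _] := sfamilyP E; have [_ SE' _] := sfamilyP E'.
exact: (premeasure_le algS).
Qed.

HB.instance Definition _ (A : Type) :=
  Order.isOrderMorphism.Build _ (sfamily S A) _ (nneg_fun R A)
    (@premeasure_component algS A) (@premeasure_component_le A).

(** This is additivity over the countable fibers of [f]. *)
Lemma premeasure_component_natural (A A' : countType) (f : finpmap A A') :
  nneg_fun_map f \o @premeasure_component algS A =1
  @premeasure_component algS A' \o sfamily_map algS f.
Proof.
move=> E; apply: nneg_fun_ext => b /=.
have [tE SE _] := sfamilyP E.
have [_ SfE _] := sfamilyP (sfamily_map algS f E).
rewrite (premeasure_bigcup algS pmu) => [//||//|]; last exact: SfE.
exact: sub_trivIset tE.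
Qed.

Definition trans_of_premeasure :
    strict_trans (sfamily_functor algS) (nneg_fun_functor R) :=
  @StrictTrans _ part_cf _ _ (sfamily_functor algS) (nneg_fun_functor R)
    (fun A : countType => @premeasure_component algS A)
    premeasure_component_natural.

End TransOfPremeasure.

(** * From strict transformations to premeasures *)

Definition restrict_unit (A : Type) (D : set A) (a : A) : option unit :=
  if a \in D then Some tt else None.

Lemma finite_restrict_unit (A : Type) (D : set A) :
  fin_cofin D -> finite_pmap (restrict_unit D).
Proof.
(* A preimage is [D] if [B'] contains the point, and empty otherwise. *)
move=> fD B' _; have [B't|B't] := pselect (B' tt).
  suff -> : ppreimage (restrict_unit D) B' = D by [].
  apply/seteqP; split=> a; rewrite /ppreimage/= /restrict_unit.
    by case: ifPn => [/set_mem//|_ [b]].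
  by move=> Da; exists tt => //; rewrite ifT// inE.
left; suff -> : ppreimage (restrict_unit D) B' = set0 by exact: finite_set0.
by apply/seteqP; split=> a // [[]].
Qed.

Lemma fiber_restrict_unit (A : Type) (D : set A) :
  fiber (restrict_unit D) tt = D.
Proof.
apply/seteqP; split=> a; rewrite /fiber/= /restrict_unit.
  by case: ifPn => [/set_mem|].
by move=> Da; rewrite ifT// inE.
Qed.

Lemma set_family_unit (X : Type) (S : set (set X)) P :
  S P -> set_family S (fun _ : unit => P).
Proof.
move=> SP; split=> [[] []//|//|].
suff -> : \bigcup_(_ : unit) P = P by [].
by apply/seteqP; split=> [x [_ _]//|x Px]; exists tt.
Qed.

Section PremeasureOfTrans.
Context {R : realType} {X : Type} {S : set (set X)} {algS : set_algebra S}.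
Variable tau : strict_trans (sfamily_functor algS) (nneg_fun_functor R).

Definition sfamily_unit P (SP : S P) : sfamily S unit :=
  SFamily (asboolT (set_family_unit SP)).

(** The default 0 keeps the function nonnegative off [S], as [premeasure] demands. *)
Definition premeasure_of_trans (P : set X) : \bar R :=
  if pselect (S P) is left SP
  then nneg_fun_val (tau (unit : countType) (sfamily_unit SP)) tt else 0.

Lemma premeasure_of_trans_ge0 P : 0 <= premeasure_of_trans P.
Proof.
by rewrite /premeasure_of_trans; case: pselect => // SP; exact: nneg_funP.
Qed.

(** Naturality along [restrict_unit D]. Singletons [D] recover the components of [tau], the full set
    gives countable additivity, and the empty set gives the value 0 at [set0]. *)
Lemma premeasure_of_trans_bigcup (A : countType) (E : sfamily S A) (D : set A) :
  fin_cofin D ->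
  premeasure_of_trans (\bigcup_(a in D) E a) =
  \esum_(a in D) nneg_fun_val (tau A E) a.
Proof.
move=> fD; pose f : @Defs.hom _ part_cf A unit :=
  FinPMap (asboolT (finite_restrict_unit fD)).
have SDE : S (\bigcup_(a in D) E a).
  by apply: bigcup_fin_cofin => //; exact: sfamilyP.
have /= := naturality tau f E.
move=> /(congr1 (fun p => nneg_fun_val p tt)) /=.
rewrite fiber_restrict_unit => ->; rewrite /premeasure_of_trans.
case: pselect => // SP; congr (nneg_fun_val (tau _ _) _).
by apply: sfamily_ext => -[] /=; rewrite fiber_restrict_unit.
Qed.

Lemma premeasure_of_transE (A : countType) (E : sfamily S A) (a : A) :
  nneg_fun_val (tau A E) a = premeasure_of_trans (E a).
Proof.
rewrite -[in RHS](bigcup_set1 E a) premeasure_of_trans_bigcup.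
  by rewrite esum_set1//; exact: nneg_funP.
by left; exact: finite_set1.
Qed.

Lemma premeasure_of_transP : premeasure S premeasure_of_trans.
Proof.
have [S0 _ _] := algS.
split=> [|P|F SF tF SUF]; last 2 first.
- exact: premeasure_of_trans_ge0.
(* A disjoint sequence in [S] with union in [S] is exactly a family indexed by [nat]. *)
- pose E : sfamily S nat := SFamily (asboolT (And3 tF SF SUF)).
  rewrite nneseries_esumT => [|n]; last exact: premeasure_of_trans_ge0.
  transitivity
    (\esum_(n in [set: nat]) nneg_fun_val (tau (nat : countType) E) n).
    rewrite -premeasure_of_trans_bigcup//.
    by right; rewrite setCT; exact: finite_set0.
  by apply: eq_esum => n _; exact: premeasure_of_transE.
have := @premeasure_of_trans_bigcup unit (sfamily_unit S0) set0.
by rewrite bigcup_set0 esum_set0; apply; left; exact: finite_set0.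
Qed.

End PremeasureOfTrans.

Theorem theorem7p3 (R : realType) (X : Type) (B : set (set X))
    (algB : set_algebra B)
    (tau : strict_trans (sfamily_functor algB) (nneg_fun_functor R)) :
  exists rho : strict_trans (sfamily_functor (sigma_set_algebra B))
                            (nneg_fun_functor R),
    is_right_extension (sigma_inclusion algB) tau rho /\
    is_proper_extension (sigma_inclusion algB) tau rho.
Proof.
have [nu [pnu nuE nu_max]] :=
  premeasure_extension algB (premeasure_of_transP tau).
exists (trans_of_premeasure (sigma_set_algebra B) pnu).
have proper : is_proper_extension (sigma_inclusion algB) tau
    (trans_of_premeasure (sigma_set_algebra B) pnu).
  apply: strict_trans_ext => A E; apply: nneg_fun_ext => a /=.
  by have [_ BE _] := sfamilyP E; rewrite nuE// premeasure_of_transE.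
split=> //; split; first by rewrite proper => A E; exact: lexx.
move=> tau' tau'_le A E; apply/nneg_fun_leP => a /=.
have [_ SE _] := sfamilyP E.
(* [tau'] also comes from a premeasure on [<<s B >>], so maximality of [nu] applies; the bound
   required on [B] is [tau'_le] at the one-point set. *)
rewrite premeasure_of_transE; apply: nu_max => [|P BP|//].
  exact: premeasure_of_transP.
have /nneg_fun_leP/(_ tt) := tau'_le (unit : countType) (sfamily_unit BP).
by rewrite /= !premeasure_of_transE.
Qed.
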